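(* Let $d > 1$ be an integer. There exist a velocity field $b \in L^\infty((0,1); L^d(\mathbb{R}^d;\mathbb{R}^d)) \cap C^\infty([0,1)\times \mathbb{R}^d;\mathbb{R}^d)$ and a smooth solution $u \in C^\infty([0,1)\times \mathbb{R}^d) \cap L^2((0,1); L^{\frac{d}{d-1}}(\mathbb{R}^d))$ of $$\partial_t u + \operatorname{div}(bu) = \Delta u \quad \text{in } [0,1)\times\mathbb{R}^d,$$ with initial datum $u_0 = u(0,\cdot) \in L^2(\mathbb{R}^d) \cap L^{\frac{d}{d-1}}(\mathbb{R}^d) \cap L^\infty(\mathbb{R}^d) \cap C^\infty(\mathbb{R}^d)$, such that $$\limsup_{t\to 1^-} u(t,0) = \infty, \qquad \lim_{t\to 1^-} \|u(t,\cdot) \|_{L^{\frac{d}{d-1}}(\mathbb{R}^d)} = \infty, \qquad \text{and} \qquad \lim_{t\to 1^-} \|u(t,\cdot) \|_{L^2(\mathbb{R}^d)} = \infty .$$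
   Context: Here $b=b(t,x)$ is $\mathbb{R}^d$-valued and $u=u(t,x)$ is real-valued; $\operatorname{div}$ and $\Delta$ act on the space variable $x\in\mathbb{R}^d$ only. For $1\le r,q\le\infty$, $L^r((0,1);L^q(\mathbb{R}^d))$ is the space of measurable functions $f$ on $(0,1)\times\mathbb{R}^d$ for which $t\mapsto\|f(t,\cdot)\|_{L^q(\mathbb{R}^d)}$ belongs to $L^r((0,1))$. *)

(* Defs.v *)
From HB Require Import structures.
From mathcomp Require Import all_boot all_order all_algebra.
From mathcomp Require Import all_classical all_reals all_analysis.
From mathcomp Require Import measurable_realfun ess_sup_inf.

Set Implicit Arguments.
Unset Strict Implicit.
Unset Printing Implicit Defensive.

Import Order.TTheory GRing.Theory Num.Theory.
Import numFieldNormedType.Exports.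

Local Open Scope classical_set_scope.
Local Open Scope ring_scope.

Definition measure_rV_display : measure_display -> measure_display.
Proof. exact. Qed.

Section measurable_rV.
Context {R : realType}.
Variable n : nat.

(* The product sigma-algebra of R^n, as the library does for n.-tuple. *)
Let coords : 'I_n -> 'rV[R]_n -> R := fun i x => x ord0 i.

Let rV_set0 : g_sigma_preimage coords set0.
Proof. exact: sigma_algebra0. Qed.

Let rV_setC A : g_sigma_preimage coords A -> g_sigma_preimage coords (~` A).
Proof. exact: sigma_algebraC. Qed.

Let rV_bigcup (F : _^nat) : (forall i, g_sigma_preimage coords (F i)) ->
  g_sigma_preimage coords (\bigcup_i (F i)).
Proof. exact: sigma_algebra_bigcup. Qed.

HB.instance Definition _ := @isMeasurable.Build
  (measure_rV_display default_measure_display)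
  'rV[R]_n (g_sigma_preimage coords) rV_set0 rV_setC rV_bigcup.

End measurable_rV.

Section lebesgue_rV.
Context {R : realType}.

Definition rVcons n (p : measurableTypeR R * 'rV[R]_n) : 'rV[R]_n.+1 :=
  row_mx (const_mx p.1 : 'rV[R]_1) p.2.

Lemma rVcons0 n p : @rVcons n p ord0 ord0 = p.1.
Proof.
rewrite /rVcons (_ : ord0 = lshift n (ord0 : 'I_1)); last exact: val_inj.
by rewrite (row_mxEl (const_mx p.1 : 'rV[R]_1)) mxE.
Qed.

Lemma rVconsS n p (i : 'I_n) : rVcons p ord0 (lift ord0 i) = p.2 ord0 i.
Proof.
rewrite /rVcons (_ : lift ord0 i = rshift 1 i); last exact: val_inj.
by rewrite (row_mxEr (const_mx p.1 : 'rV[R]_1)).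
Qed.

Lemma measurable_coord n (i : 'I_n) :
  measurable_fun [set: 'rV[R]_n] (fun x : 'rV[R]_n => x ord0 i).
Proof.
move=> _ Y mY; rewrite setTI; apply: sub_sigma_algebra => /=.
rewrite -bigcup_seq/=; exists i => /=; first by rewrite mem_index_enum.
by exists Y => //; rewrite setTI.
Qed.

Lemma measurable_fun_coordP d (T : measurableType d) n (f : T -> 'rV[R]_n) :
  measurable_fun [set: T] f <->
  forall i, measurable_fun [set: T] (fun x => f x ord0 i).
Proof.
split=> [mf i|mf _ A mA].
  by apply: (measurableT_comp (measurable_coord i)).
rewrite setTI; move: A mA; apply: smallest_sub.
  split; first by rewrite /= preimage_set0.
    by move=> A mA; rewrite /= setTD preimage_setC; exact: measurableC.
  by move=> F mF; rewrite /= preimage_bigcup; exact: bigcup_measurable.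
rewrite -bigcup_seq => A [i _ [B mB <-]] /=.
by have := mf i measurableT B mB; rewrite !setTI.
Qed.

Lemma measurable_rVcons n : measurable_fun setT (@rVcons n).
Proof.
apply/measurable_fun_coordP => i; case: (unliftP ord0 i) => [j|] ->.
- rewrite (_ : (fun _ => _) = (fun x : 'rV[R]_n => x ord0 j) \o snd); last first.
    by apply/funext => p /=; rewrite rVconsS.
  by apply: measurableT_comp => //; exact: measurable_coord.
- rewrite (_ : (fun _ => _) = fst) //; last first.
    by apply/funext => p /=; rewrite rVcons0.
Qed.

Section step.
Variables (n : nat) (mu : {sigma_finite_measure set 'rV[R]_n -> \bar R}).

Definition lebesgue_rVS : set 'rV[R]_n.+1 -> \bar R :=
  pushforward (lebesgue_measure \x mu)%E (@rVcons n).

Let lebesgue_rVS0 : lebesgue_rVS set0 = 0%E.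
Proof. by rewrite /lebesgue_rVS /pushforward preimage_set0 measure0. Qed.

Let lebesgue_rVS_ge0 A : (0 <= lebesgue_rVS A)%E.
Proof. by rewrite /lebesgue_rVS /pushforward; exact: measure_ge0. Qed.

Let lebesgue_rVS_sigma_additive : semi_sigma_additive lebesgue_rVS.
Proof.
have mr := @measurable_rVcons n.
move=> F mF tF mUF; rewrite /lebesgue_rVS /pushforward preimage_bigcup.
apply: measure_semi_sigma_additive.
- by move=> k; rewrite -[X in measurable X]setTI; exact: mr.
- apply/trivIsetP => /= i j _ _ ij; rewrite -preimage_setI.
  by move/trivIsetP : tF => /(_ _ _ _ _ ij) ->//; rewrite preimage_set0.
- by rewrite -preimage_bigcup -[X in measurable X]setTI; exact: mr.
Qed.

HB.instance Definition _ := isMeasure.Build _ _ _ lebesgue_rVS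
  lebesgue_rVS0 lebesgue_rVS_ge0 lebesgue_rVS_sigma_additive.

Let rVcons_inv (x : 'rV[R]_n.+1) : measurableTypeR R * 'rV[R]_n :=
  (x ord0 ord0, \row_i x ord0 (lift ord0 i)).

Let rVconsK p : rVcons_inv (@rVcons n p) = p.
Proof.
case: p => a v; rewrite /rVcons_inv rVcons0; congr pair.
by apply/rowP => i; rewrite mxE rVconsS.
Qed.

Let measurable_rVcons_inv : measurable_fun setT rVcons_inv.
Proof.
apply/measurable_fun_pairP; split; first exact: measurable_coord.
apply/measurable_fun_coordP => i.
under eq_fun do rewrite /= mxE.
exact: measurable_coord.
Qed.

Let lebesgue_rVS_sigma_finite : sigma_finite setT lebesgue_rVS.
Proof.
have /sigma_finiteP[F [UF ndF Foo]] := sigma_finiteT (@lebesgue_measure R).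
have /sigma_finiteP[G [UG ndG Goo]] := sigma_finiteT mu.
exists (fun k => rVcons_inv @^-1` (F k `*` G k)).
  rewrite -preimage_bigcup (_ : \bigcup_k _ = setT) ?preimage_setT//.
  rewrite -setXTT UF UG predeqE => -[x y]; split.
    by move=> [k _ []/= ? ?]; split; exists k.
  move=> [/= [k _ Fkx] [m _ Gmy]]; exists (maxn k m) => //; split.
  - by move: x Fkx; exact/subsetPset/ndF/leq_maxl.
  - by move: y Gmy; exact/subsetPset/ndG/leq_maxr.
move=> k; have [mF Fkoo] := Foo k; have [mG Gkoo] := Goo k; split.
  rewrite -[X in measurable X]setTI.
  by apply: measurable_rVcons_inv => //; exact: measurableX.
rewrite /lebesgue_rVS /pushforward -comp_preimage.
rewrite (_ : rVcons_inv \o _ = id); last by apply/funext => p /=; exact: rVconsK.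
by rewrite preimage_id product_measure1E// lte_mul_pinfty// ge0_fin_numE.
Qed.

HB.instance Definition _ := Measure_isSigmaFinite.Build _ _ _ lebesgue_rVS
  lebesgue_rVS_sigma_finite.

End step.

Fixpoint lebesgue_rV n : {sigma_finite_measure set 'rV[R]_n -> \bar R} :=
  if n is m.+1 then lebesgue_rVS (lebesgue_rV m) else @dirac _ 'rV[R]_0 0 R.

Lemma lebesgue_rV_box n (A : 'I_n -> set R) : (forall i, measurable (A i)) ->
  lebesgue_rV n [set x | forall i, A i (x ord0 i)] =
  (\prod_(i < n) lebesgue_measure (A i : set (measurableTypeR R)))%E.
Proof.
elim: n A => [|n IHn] A mA.
  rewrite big_ord0 /= diracE mem_set// => -[].
  by [].
rewrite big_ord_recl -IHn//= /lebesgue_rVS /pushforward.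
pose B := [set x : 'rV[R]_n | forall i, A (lift ord0 i) (x ord0 i)].
have -> : @rVcons n @^-1` [set x | forall i, A i (x ord0 i)] = A ord0 `*` B.
  apply/seteqP; split=> [[a v] /= Aav|[a v] /= [Aa Av] i].
    split=> [|i] /=; first by have := Aav ord0; rewrite rVcons0.
    by have := Aav (lift ord0 i); rewrite rVconsS.
  by case: (unliftP ord0 i) => [j|] ->; rewrite ?rVconsS ?rVcons0//; exact: Av.
rewrite product_measure1E//; first exact: (mA ord0).
rewrite (_ : B = \bigcap_(i in [set: 'I_n])
    ((fun x : 'rV[R]_n => x ord0 i) @^-1` A (lift ord0 i))).
  apply: fin_bigcap_measurable => // i _; rewrite -[X in measurable X]setTI.
  exact: measurable_coord.
by apply/seteqP; split=> [x Bx i _|x Bx i]; [exact: Bx|exact: Bx i I].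
Qed.

End lebesgue_rV.

Section function_spaces.
Context {R : realType} {d : nat}.
Local Open Scope ereal_scope.

(* L^r((0,1); L^q(R^d)); only the values on (0,1) x R^d matter. *)
Definition LrLq (r q : \bar R) (f : R -> 'rV[R]_d -> R) : Prop :=
  let N t := 'N[lebesgue_rV d]_q[EFin \o f t] in
  [/\ measurable_fun (`]0%R, 1%R[ `*` setT : set (R * 'rV[R]_d))
        (fun z => f z.1 z.2),
      measurable_fun (`]0%R, 1%R[ : set R) N &
      'N[lebesgue_measure]_r[N \_ `]0%R, 1%R[] < +oo].

(* The library norm on 'rV[R]_d is the sup norm. *)
Definition eucl_norm (v : 'rV[R]_d) : R := Num.sqrt (\sum_(i < d) v ord0 i ^+ 2)%R.

Definition LrLq_rV (r q : \bar R) (f : R -> 'rV[R]_d -> 'rV[R]_d) : Prop :=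
  measurable_fun (`]0%R, 1%R[ `*` setT : set (R * 'rV[R]_d))
        (fun z => f z.1 z.2) /\
  LrLq r q (fun t x => eucl_norm (f t x)).

End function_spaces.

Section smooth.
Context {R : realType} {d : nat}.

Definition partial_x (i : 'I_d) (f : 'rV[R]_d -> R) (x : 'rV[R]_d) : R :=
  'D_(delta_mx ord0 i) f x.

Definition divergence (F : 'rV[R]_d -> 'rV[R]_d) (x : 'rV[R]_d) : R :=
  \sum_(i < d) partial_x i (fun y => F y ord0 i) x.

Definition laplacian (f : 'rV[R]_d -> R) (x : 'rV[R]_d) : R :=
  \sum_(i < d) partial_x i (partial_x i f) x.

Definition iter_partial_x (s : seq 'I_d) (f : 'rV[R]_d -> R) :=
  foldr partial_x f s.

Definition smooth_x (f : 'rV[R]_d -> R) : Prop :=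
  forall s : seq 'I_d, continuous (iter_partial_x s f) /\
    forall i x, derivable (iter_partial_x s f) x (delta_mx ord0 i).

(* The time derivative is taken relative to [0, 1): it is two-sided at
   0 < t < 1 and one-sided at t = 0, and values outside [0, 1) are ignored. *)
Definition diff_quot_t (f : R -> 'rV[R]_d -> R) (t : R) (x : 'rV[R]_d) (s : R) : R :=
  (f s x - f t x) / (s - t).

Definition derivable_t f t x : Prop :=
  cvg (diff_quot_t f t x @ within `[0, 1[ t^').

Definition partial_t f t x : R := lim (diff_quot_t f t x @ within `[0, 1[ t^').

(* [None] differentiates in t, [Some i] in x_i. *)
Definition partial_tx (o : option 'I_d) (f : R -> 'rV[R]_d -> R) :=
  if o is Some i then fun t => partial_x i (f t) else partial_t f.

Definition iter_partial_tx (s : seq (option 'I_d)) (f : R -> 'rV[R]_d -> R) :=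
  foldr partial_tx f s.

(* C^oo([0,1) x R^d): all iterated partial derivatives exist and are
   continuous on [0,1) x R^d, up to t = 0. *)
Definition smooth_tx (f : R -> 'rV[R]_d -> R) : Prop :=
  forall s : seq (option 'I_d),
    let g := iter_partial_tx s f in
    [/\ {within `[0, 1[ `*` setT, continuous (fun z : R * 'rV[R]_d => g z.1 z.2)},
        forall t x, 0 <= t < 1 -> derivable_t g t x &
        forall t x i, 0 <= t < 1 -> derivable (g t) x (delta_mx ord0 i)].

Definition smooth_tx_rV (f : R -> 'rV[R]_d -> 'rV[R]_d) : Prop :=
  forall i, smooth_tx (fun t x => f t x ord0 i).

End smooth.

(* Main.v *)
Require Import Defs.
From HB Require Import structures.
From mathcomp Require Import all_boot all_order all_algebra.
From mathcomp Require Import all_classical all_reals all_analysis.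
From mathcomp Require Import measurable_realfun ess_sup_inf.
From mathcomp Require Import ring lra.
Set Implicit Arguments.
Unset Strict Implicit.
Unset Printing Implicit Defensive.
Import Order.TTheory GRing.Theory Num.Theory.
Import numFieldNormedType.Exports.
Local Open Scope classical_set_scope.
Local Open Scope ring_scope.

(** The solution is explicit and self-similar. Put [tau = 1 - t],
    [P = tau + |x|^2], [theta = tau / P] and [a = d - 1/2], and let
      [u = P^(-a/2) (1 - a theta + 2 a (a + 2) theta^2)].
    In the variable [y = x / sqrt tau] this is [tau^(-a/2) U(y)] for a positive
    smooth profile [U] which decays like [|y|^(-a)].

    Any positive function is transported by some velocity: if [u = div (x m)],
    then [b = (grad u - x d_t m) / u] satisfies
      [div (b u) = laplacian u - div (x d_t m) = laplacian u - d_t u].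
    The point is the size of [b], since a velocity that decays only like
    [1 / |y|] misses L^d by a logarithm. The potential
    [m = 2 P^(-a/2) + 2 a tau P^(-a/2-1)] gives the above [u], and the
    coefficient [2 a] is exactly the one for which the slowly decaying terms of
    [grad u - x d_t m] cancel ([flux_identity]). What remains is
      [b = - K tau^2 x / (P^3 (1 - a theta + 2 a (a + 2) theta^2))],
    with [K = 2 a (a + 2) (a + 4)], so that [|b| <= 2 K sqrt tau / P], which
    scales like [tau^(-1/2) B(x / sqrt tau)] with [B] in L^d; the L^d norm is
    bounded uniformly in time.

    Since [P^(-a/2) / 2 <= u <= C P^(-a/2)], the L^p norm of [u(t)] is of order
    [tau^(d/(2p) - a/2)] whenever [a p > d] ([Lnorm_decay_le] and
    [Lnorm_decay_ge]). For [p = d/(d-1)] the exponent is [- 1/4]: the norm blows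
    up, but it is square integrable in time. For [p = 2] the exponent is
    [(1 - d)/4], which is negative, and [u(t, 0)] is of order [tau^(-a/2)].

    Smoothness and measurability come from a small language of expressions that
    is closed under partial derivatives ([agree_smooth_tx]). *)

(** * Smooth functions given by expressions *)

Section expressions.
Context {R : realType} {d : nat}.

(** A syntax for the functions of (t, x) that occur below. Symbolic
    differentiation maps it to itself, which turns the infinitely many
    conditions of smoothness into one induction on the number of derivatives. *)
Inductive expr : Type :=
| Cst of R
| Tm
| Crd of 'I_d
| Add of expr & expr
| Mul of expr & expr
| Pow of expr & R.

Fixpoint eval (e : expr) (t : R) (x : 'rV[R]_d) : R :=
  match e with
  | Cst c => c
  | Tm => t
  | Crd i => x ord0 i
  | Add e1 e2 => eval e1 t x + eval e2 t x
  | Mul e1 e2 => eval e1 t x * eval e2 t x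
  | Pow e1 r => eval e1 t x `^ r
  end.

(** Real powers are only differentiated at positive bases; positivity is
    demanded for all [t < 1], negative times included, so that time
    derivatives at [t = 0] are two-sided. *)
Fixpoint admissible (e : expr) : Prop :=
  match e with
  | Add e1 e2 | Mul e1 e2 => admissible e1 /\ admissible e2
  | Pow e1 _ => admissible e1 /\ forall t x, t < 1 -> 0 < eval e1 t x
  | _ => True
  end.

Fixpoint derivative (o : option 'I_d) (e : expr) : expr :=
  match e with
  | Cst _ => Cst 0
  | Tm => Cst (o == None)%:R
  | Crd i => Cst (o == Some i)%:R
  | Add e1 e2 => Add (derivative o e1) (derivative o e2)
  | Mul e1 e2 => Add (Mul e1 (derivative o e2)) (Mul e2 (derivative o e1))
  | Pow e1 r => Mul (Mul (Cst r) (Pow e1 (r - 1))) (derivative o e1)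
  end.

Lemma admissible_derivative o e : admissible e -> admissible (derivative o e).
Proof. by elim: e => //= [e1 h1 e2 h2|e1 h1 e2 h2|e h r] []; tauto. Qed.

Lemma measurable_eval e :
  measurable_fun [set: R * 'rV[R]_d] (fun z => eval e z.1 z.2).
Proof.
elim: e => [c||i|e1 h1 e2 h2|e1 h1 e2 h2|e h r] /=.
- exact: measurable_cst.
- exact: measurable_fst.
- exact: (measurableT_comp (measurable_coord i) measurable_snd).
- exact: (measurable_funD h1 h2).
- exact: (measurable_funM h1 h2).
- exact: (measurableT_comp (measurable_powR r) h).
Qed.

Lemma continuous_eval e (z : R * 'rV[R]_d) : admissible e -> z.1 < 1 ->
  {for z, continuous (fun z : R * 'rV[R]_d => eval e z.1 z.2)}.
Proof.
move=> + z1; elim: e => [c||i|e1 h1 e2 h2|e1 h1 e2 h2|e h r] /=.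
- by move=> _; exact: cvg_cst.
- by move=> _; exact: cvg_fst.
- move=> _; apply: (@continuous_comp _ _ _ snd (fun y : 'rV[R]_d => y ord0 i)).
    exact: cvg_snd.
  exact: coord_continuous.
- by case=> /h1 {}h1 /h2 {}h2; exact: cvgD.
- by case=> /h1 {}h1 /h2 {}h2; exact: cvgM.
- case=> /h {}h e_gt0.
  have e0 : 0 < eval e z.1 z.2 by exact: e_gt0.
  apply: (@continuous_comp _ _ _ (fun z => eval e z.1 z.2)
                                 (fun y : R => y `^ r)) => //.
  apply/differentiable_continuous/derivable1_diffP.
  by have [] := is_derive1_powR r e0.
Qed.

(** Direction in R x R^d of the derivative named by [o]; with it, time and
    space derivatives are both derivatives at 0 along a line. *)
Definition dir_t (o : option 'I_d) : R := (o == None)%:R.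
Definition dir_x (o : option 'I_d) : 'rV[R]_d :=
  if o is Some i then delta_mx ord0 i else 0.

Lemma is_derive_eval o e t x : admissible e -> t < 1 ->
  is_derive (0 : R) 1
    (fun h : R => eval e (t + h * dir_t o) (x + h *: dir_x o))
    (eval (derivative o e) t x).
Proof.
move=> + t1; elim: e => [c||i|e1 h1 e2 h2|e1 h1 e2 h2|e h r] /=.
- by move=> _; exact: is_derive_cst.
- move=> _; rewrite (_ : (fun _ => _) = cst t + dir_t o \*: id); last first.
    by apply/funext => h; rewrite mulrC.
  by apply: is_derive_eq; rewrite add0r scaler1.
- move=> _; rewrite (_ : (fun _ => _) = cst (x ord0 i) + dir_x o ord0 i \*: id).
    apply: is_derive_eq; rewrite add0r scaler1; case: o => [j|] /=.
      by rewrite mxE eqxx /= (inj_eq Some_inj) eq_sym.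
    by rewrite mxE.
  by apply/funext => h; rewrite !mxE /= mulrC.
- by case=> /h1 {}h1 /h2 {}h2; exact: is_deriveD.
- case=> /h1 {}h1 /h2 {}h2; apply: is_derive_eq (is_deriveM h1 h2) _.
  by rewrite mul0r addr0 scale0r addr0.
- case=> /h {}h e_gt0.
  have e0 : 0 < eval e (t + 0 * dir_t o) (x + 0 *: dir_x o).
    by rewrite mul0r addr0 e_gt0.
  have := is_derive1_comp (is_derive1_powR r e0) h.
  by rewrite mul0r addr0 scale0r addr0.
Qed.

Lemma is_derive_eval_x i (e : expr) t x : admissible e -> t < 1 ->
  is_derive x (delta_mx ord0 i) (eval e t) (eval (derivative (Some i) e) t x).
Proof.
move=> ae t1; have := is_derive_eval (Some i) x ae t1.
rewrite (_ : (fun h : R => eval e _ _) =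
    fun h : R => eval e t (h *: delta_mx ord0 i + x)); last first.
  by apply/funext => h; rewrite /dir_t /= mulr0 addr0 addrC.
case=> dg eg; apply: DeriveDef; first exact: (derivable1P _ _ _).2.
rewrite -eg /derive; set g1 := fun h => h^-1 *: _; set g2 := fun h => h^-1 *: _.
suff -> : g1 = g2 by [].
apply/funext => h; rewrite /g1 /g2 /=.
by rewrite scale0r add0r addr0 [h *: 1]mulr1.
Qed.

Lemma cvg_diff_quot_eval (e : expr) t x : admissible e -> t < 1 ->
  diff_quot_t (eval e) t x s @[s --> t^'] --> eval (derivative None e) t x.
Proof.
move=> ae t1; have := is_derive_eval None x ae t1.
rewrite (_ : (fun h : R => eval e _ _) = fun h : R => eval e (t + h) x); last first.
  by apply/funext => h; rewrite /dir_t /= mulr1 scaler0 addr0.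
case=> dg eg.
have {}dg : (h^-1 *: (eval e (t + h) x - eval e t x)) @[h --> 0^'] -->
    eval (derivative None e) t x.
  have -> : (fun h => h^-1 *: (eval e (t + h) x - eval e t x)) =
      (fun h => h^-1 *: (((fun h : R => eval e (t + h) x) \o shift 0) (h *: 1) -
                 eval e (t + 0) x)).
    by apply/funext => h /=; rewrite !addr0 [h *: 1]mulr1.
  by rewrite -eg; exact: dg.
move=> A /dg /=; rewrite /nbhs /=.
move=> [eps eps0 h]; exists eps => //= s /= ts snet.
have := h (s - t) => /=; rewrite sub0r normrN addrCA subrr addr0 distrC.
move=> /(_ ts); rewrite subr_eq0 => /(_ snet).
by rewrite /diff_quot_t /GRing.scale /= mulrC.
Qed.

(** Agreement on [0, 1) only: this is all that the one-sided time derivative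
    sees, and it is stable under [partial_tx]. *)
Definition agree (f : R -> 'rV[R]_d -> R) (e : expr) :=
  forall t, 0 <= t < 1 -> f t = eval e t.

(** Every [t] in [0, 1) is approached from its right inside [0, 1), so limits
    relative to [0, 1) are unique, also at [t = 0]. *)
Lemma within_itv01_proper (t : R) : 0 <= t < 1 ->
  ProperFilter (within `[0%R, 1%R[ t^').
Proof.
move=> /andP[t0 t1]; apply: Build_ProperFilter_ex => A /= [eps /= eps0 h].
(* t + r stays below 1 and within eps of t *)
pose r := Num.min (eps / 2) ((1 - t) / 2).
have r0 : 0 < r by rewrite lt_min !divr_gt0// subr_gt0.
exists (t + r); apply: (h (t + r)) => /=.
- rewrite opprD addNKr normrN gtr0_norm// /r gt_min.
  by rewrite ltr_pdivrMr// ltr_pMr// ltr1n.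
- by rewrite gt_eqF// ltrDl.
- rewrite in_itv /= addr_ge0 ?(ltW r0)//= -ltrBrDl gt_min; apply/orP; right.
  by rewrite ltr_pdivrMr// ltr_pMr ?subr_gt0// ltr1n.
Qed.

Lemma cvg_diff_quot f e t x : admissible e -> agree f e -> 0 <= t < 1 ->
  diff_quot_t f t x s @[s --> within `[0%R, 1%R[ t^'] -->
  eval (derivative None e) t x.
Proof.
move=> ae fe t01; have /andP[_ t1] := t01.
move=> A /(cvg_diff_quot_eval ae t1) hA.
change (t^' [set s | s \in `[0%R, 1%R[ -> A (diff_quot_t f t x s)]).
apply: (@filterS _ t^' _ [set s | A (diff_quot_t (eval e) t x s)]) hA.
move=> s /= + s01; by rewrite /diff_quot_t (fe _ s01) (fe _ t01).
Qed.

Lemma agree_partial_tx o f e : admissible e -> agree f e ->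
  agree (partial_tx o f) (derivative o e).
Proof.
move=> ae fe t t01; apply/funext => x; have /andP[_ t1] := t01.
case: o => [i|] /=.
  rewrite fe// /partial_x; have [_ ->//] := is_derive_eval_x i x ae t1.
rewrite /partial_t; have FF := within_itv01_proper t01.
by apply/cvg_lim => //; exact: cvg_diff_quot.
Qed.

Lemma agree_smooth_tx f e : admissible e -> agree f e -> smooth_tx f.
Proof.
move=> ae fe s g.
have [e' [ae' fe']] : exists e', admissible e' /\ agree g e'.
  rewrite {}/g.
  elim: s => [|o s [e' [ae' fe']]]; first by exists e.
  exists (derivative o e'); split; first exact: admissible_derivative.
  exact: agree_partial_tx.
clearbody g; split.
- apply/subspace_continuousP => -[t x] [/= t01 _].
  have /andP[_ t1] : 0 <= t < 1 by [].
  rewrite /from_subspace /= => A; rewrite fe'// => /(@continuous_eval e' (t, x) ae' t1) hA.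
  apply: (@filterS _ (nbhs (t, x)) _
    [set z : R * 'rV[R]_d | A (eval e' z.1 z.2)]) hA => -[r y] /= + [/= r01 _].
  by rewrite fe'.
- by move=> t x t01; apply/cvg_ex; eexists; exact: (@cvg_diff_quot _ _ _ x ae' fe' t01).
- move=> t x i t01; rewrite fe'//; have /andP[_ t1] := t01.
  by have [] := is_derive_eval_x i x ae' t1.
Qed.

Lemma smooth_x_eval (e : expr) t : admissible e -> t < 1 -> smooth_x (eval e t).
Proof.
move=> ae t1 s.
have [e' [ae' ->]] :
    exists e', admissible e' /\ iter_partial_x s (eval e t) = eval e' t.
  elim: s => [|i s [e' [ae' /= ->]]]; first by exists e.
  exists (derivative (Some i) e'); split; first exact: admissible_derivative.
  apply/funext => x; rewrite /partial_x.
  by have [_ ->] := is_derive_eval_x i x ae' t1.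
split=> [x|i x]; last by have [] := is_derive_eval_x i x ae' t1.
have := @continuous_eval e' (t, x) ae' t1.
move=> ce; apply: (@continuous_comp _ _ _ (fun y => (t, y))
  (fun z : R * 'rV[R]_d => eval e' z.1 z.2)) => //.
exact: (@cvg_pair _ _ _ (nbhs x) (nbhs t) (nbhs x) _ _ _ (fun=> t) id
  (@cvg_cst _ t _ (nbhs x) _) cvg_id).
Qed.

End expressions.

(** * Product and one-dimensional integrals *)

Section rV_integrals.
Context {R : realType}.
Local Notation leb := (@lebesgue_measure R).

Lemma measurable_prod_coord n (f : R -> R) : measurable_fun setT f ->
  measurable_fun [set: 'rV[R]_n] (fun x : 'rV[R]_n => \prod_(i < n) f (x ord0 i)).
Proof.
move=> mf; apply: (@measurable_prod _ _ _ _ _ _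
  (fun (i : 'I_n) (x : 'rV[R]_n) => f (x ord0 i))) => i _.
exact: (measurableT_comp mf (measurable_coord i)).
Qed.

(** Tonelli, one coordinate at a time. *)
Lemma integral_prod_coord_le n (f : R -> R) (c : R) : measurable_fun setT f ->
  (forall x, 0 <= f x) -> 0 <= c ->
  (\int[leb]_x (f x)%:E <= c%:E)%E ->
  (\int[lebesgue_rV n]_x (\prod_(i < n) f (x ord0 i))%:E <= (c ^+ n)%:E)%E.
Proof.
move=> mf f0 c0 fc; elim: n => [|n IHn].
  rewrite (_ : (fun x => _) = cst 1%E); last first.
    by apply/funext => x; rewrite big_ord0.
  rewrite integral_cst// mul1e expr0 /= diracT //.
have mprod k := @measurable_prod_coord k f mf.
have prod0 k (x : 'rV[R]_k) : 0 <= \prod_(i < k) f (x ord0 i) by exact: prodr_ge0.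
(* unfolds the recursive definition of the measure on R^(n+1) *)
have -> : (\int[lebesgue_rV n.+1]_x (\prod_(i < n.+1) f (x ord0 i))%:E)%E =
   (\int[pushforward (lebesgue_measure \x lebesgue_rV n)%E (@rVcons R n)]_x
      (\prod_(i < n.+1) f (x ord0 i))%:E)%E by [].
rewrite ge0_integral_pushforward//=; last 2 first.
- apply/measurable_EFinP. exact: mprod.
- by move=> x _; rewrite lee_fin prod0.
rewrite preimage_setT.
have E z : (\prod_(i < n.+1) f (rVcons z ord0 i))%:E =
    ((f z.1)%:E * (\prod_(i < n) f (z.2 ord0 i))%:E)%E.
  rewrite big_ord_recl rVcons0 -EFinM; congr (_ * _)%:E.
  by apply: eq_bigr => i _; rewrite rVconsS.
under eq_integral do rewrite /= E.
rewrite fubini_tonelli1//=; last 2 first.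
- apply: emeasurable_funM; apply/measurable_EFinP.
    exact: (measurableT_comp mf measurable_fst).
  exact: (measurableT_comp (mprod n) measurable_snd).
- by move=> z; rewrite mule_ge0// lee_fin ?f0 ?prod0.
rewrite /fubini_F /=.
under eq_integral => x _.
  rewrite ge0_integralZl//=; last 3 first.
  - by apply/measurable_EFinP; exact: mprod.
  - by move=> y _; rewrite lee_fin ?prod0.
  - by rewrite lee_fin f0.
  over.
rewrite ge0_integralZr//=; last 3 first.
- exact/measurable_EFinP.
- by move=> y _; rewrite lee_fin f0.
- by apply: integral_ge0 => y _; rewrite lee_fin prod0.
rewrite exprS EFinM; apply: lee_pmul => //.
- by apply: integral_ge0 => y _; rewrite lee_fin f0.
- by apply: integral_ge0 => y _; rewrite lee_fin prod0.
- exact: measurable_rVcons.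
Qed.

End rV_integrals.

Section one_variable_integrals.
Context {R : realType}.
Local Notation leb := (@lebesgue_measure R).

Lemma powRN_cvgy0 (p : R) : 0 < p -> x `^ (- p) @[x --> +oo] --> (0 : R).
Proof.
move=> p0; apply/cvgr0Pnorm_lt => eps eps0.
near=> x.
have xe : eps `^ (- p^-1) < x.
  by near: x; apply: nbhs_pinfty_gt; rewrite num_real.
have e0 : 0 < eps `^ (- p^-1) by rewrite powR_gt0.
have x0 : 0 < x := lt_trans e0 xe.
rewrite ger0_norm ?powR_ge0// powRN invf_plt ?posrE ?powR_gt0//.
rewrite -powR_inv1 ?ltW// -(_ : (eps `^ (- p^-1)) `^ p = eps `^ (-1)).
  by apply: gt0_ltr_powR; rewrite ?inE ?nnegrE ?(ltW x0) ?ltW.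
by rewrite -powRrM mulNr mulVf ?gt_eqF.
Unshelve. all: by end_near. Qed.

Lemma integral_shifted_powR (r p : R) : 0 < r -> 1 < p ->
  (\int[leb]_(x in `[0%R, +oo[) ((r + x) `^ (- p))%:E =
   ((p - 1)^-1 * r `^ (1 - p))%:E)%E.
Proof.
move=> r0 p1.
pose F (x : R) := - (p - 1)^-1 * (r + x) `^ (1 - p).
have p10 : 0 < p - 1 by rewrite subr_gt0.
have rx0 (x : R) : 0 <= x -> 0 < r + x by move=> x0; rewrite ltr_wpDr.
have dpow (s x : R) : 0 < r + x ->
    is_derive x 1 (fun x : R => (r + x) `^ s) (s * (r + x) `^ (s - 1)).
  move=> rx.
  have dr : is_derive x (1 : R) (cst r + id) (1 : R).
    by apply: is_derive_eq; rewrite add0r.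
  by have := is_derive1_comp (is_derive1_powR s rx) dr; rewrite mulr1.
have dF (x : R) : 0 < r + x -> is_derive x 1 F ((r + x) `^ (- p)).
  move=> rx; apply: is_derive_eq (is_deriveZ (- (p - 1)^-1) (dpow (1 - p) x rx)) _.
  rewrite /GRing.scale /= mulrA.
  rewrite (_ : - (p - 1)^-1 * (1 - p) = 1); last by field; rewrite gt_eqF.
  by rewrite mul1r; congr (_ `^ _); ring.
rewrite (@ge0_continuous_FTC2y R _ F 0 0).
- by rewrite /F addr0 sub0e -EFinN mulNr opprK.
- by move=> x x0; exact: powR_ge0.
- apply: continuous_in_subspaceT => x /[!inE] /= /[!in_itv] /= /andP[x0 _].
  apply/differentiable_continuous/derivable1_diffP.
  by have [] := dpow (- p) x (rx0 _ x0).
- rewrite /F -[X in _ --> X](mulr0 (- (p - 1)^-1)).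
  apply: cvgM; first exact: cvg_cst.
  have := powRN_cvgy0 p10; rewrite opprB => h.
  apply: (@cvg_comp _ _ _ (fun x => r + x) (fun y => y `^ (1 - p)) _ +oo) h.
  exact: cvg_addrl.
- move=> x x0; have [] := dF x (rx0 _ (ltW x0)) => //.
- apply: cvg_at_right_filter.
  apply/differentiable_continuous/derivable1_diffP.
  by have [] := dF 0 (rx0 _ (lexx 0)).
- move=> x /[!in_itv] /= /andP[x0 _]; rewrite derive1E.
  by have [_ ->] := dF x (rx0 _ (ltW x0)).
Qed.

(** After the reflection [x -> - x], comparison with a shifted power, which has
    an explicit primitive: [tau + x^2 >= (sqrt tau + x)^2 / 2] for [x >= 0].
    The dependence on [tau] is the exact one given by scaling. *)
Lemma integral_decay_le (sg tau : R) : 1 / 2 < sg -> 0 < tau ->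
  (\int[leb]_x ((tau + x ^+ 2) `^ (- sg))%:E <=
   (2 * (2 `^ sg / (2 * sg - 1)) * tau `^ (1 / 2 - sg))%:E)%E.
Proof.
move=> sg2 tau0.
have sg0 : 0 < sg by apply: lt_trans sg2; rewrite divr_gt0.
have p0 (x : R) : 0 < tau + x ^+ 2 by rewrite ltr_wpDr// sqr_ge0.
have cpow : continuous (fun x : R => (tau + x ^+ 2) `^ (- sg)).
  move=> x; apply: (@continuous_comp R R R (fun x : R => tau + x ^+ 2)
      (fun y : R => y `^ (- sg)) x).
    by apply: cvgD; [exact: cvg_cst|exact: exprn_continuous].
  apply/differentiable_continuous/derivable1_diffP.
  by have [] := is_derive1_powR (- sg) (p0 x).
rewrite ge0_symfun_integralT//; last 2 first.
- by move=> x; exact: powR_ge0.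
- by move=> x /=; rewrite sqrrN.
pose rt := Num.sqrt tau.
have rt0 : 0 < rt by rewrite sqrtr_gt0.
have rt2 : rt ^+ 2 = tau by rewrite sqr_sqrtr// ltW.
have mshift : measurable_fun setT (fun x : R => (rt + x) `^ (- (2 * sg))).
  apply: (measurableT_comp (measurable_powR _)) => /=.
  exact: measurable_funD.
rewrite -mulrA EFinM lee_pmul2l//.
have -> : [set x : R | 0 <= x] = `[0, +oo[%classic.
  by apply/seteqP; split=> x /=; rewrite in_itv/= andbT.
apply: (@le_trans _ _ (\int[leb]_(x in `[0%R, +oo[)
    ((2 `^ sg)%:E * ((rt + x) `^ (- (2 * sg)))%:E))%E).
  apply: ge0_le_integral => //=.
  - by move=> x _; rewrite lee_fin powR_ge0.
  - apply/measurable_EFinP; apply: measurable_funTS.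
    exact: continuous_measurable_fun.
  - apply: emeasurable_funM => //; apply/measurable_EFinP.
    exact: measurable_funTS.
  move=> x /[!in_itv]/= /andP[x0 _]; rewrite -EFinM lee_fin.
  have rx : 0 < rt + x by rewrite ltr_wpDr.
  rewrite powRN [X in _ * X]powRN powRrM powR_mulrn ?(ltW rx)//.
  rewrite -(invrK (2 `^ sg)) -invfM lef_pV2 ?posrE ?powR_gt0//; last first.
    by rewrite mulr_gt0 ?invr_gt0 ?powR_gt0// exprn_gt0.
  rewrite ler_pdivrMl ?powR_gt0// -powRM ?(ltW (p0 _))//.
  apply: ge0_ler_powR; rewrite ?nnegrE ?(ltW sg0)//.
  - by rewrite exprn_ge0// ltW.
  - by rewrite mulr_ge0// ltW.
  - by rewrite -rt2; have := sqr_ge0 (rt - x); nra.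
have mE : measurable_fun (`[0, +oo[%classic : set R)
    (fun x : R => ((rt + x) `^ (- (2 * sg)))%:E).
  by apply/measurable_EFinP; exact: measurable_funTS.
rewrite ge0_integralZl//; last first.
  by move=> x _; rewrite lee_fin powR_ge0.
rewrite integral_shifted_powR//; last first.
  by move: sg2; rewrite ltr_pdivrMr// mulrC.
rewrite -EFinM lee_fin mulrA ler_pM2l; last first.
  rewrite divr_gt0 ?powR_gt0// subr_gt0.
  by move: sg2; rewrite ltr_pdivrMr// mulrC.
rewrite /rt -powR12_sqrt ?(ltW tau0)// -powRrM le_eqVlt; apply/orP; left; apply/eqP.
by congr (_ `^ _); field.
Qed.

End one_variable_integrals.

(** * Norms of functions decaying like a power *)

Section Lnorm_bounds.
Context {R : realType}.
Local Notation leb := (@lebesgue_measure R).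

Definition sqn {n} (x : 'rV[R]_n) : R := \sum_(i < n) x ord0 i ^+ 2.

Lemma sqn_ge0 n (x : 'rV[R]_n) : 0 <= sqn x.
Proof. by apply: sumr_ge0 => i _; exact: sqr_ge0. Qed.

Lemma sqr_le_sqn n (x : 'rV[R]_n) i : x ord0 i ^+ 2 <= sqn x.
Proof.
by rewrite /sqn (bigD1 i)//= lerDl; apply: sumr_ge0 => j _; exact: sqr_ge0.
Qed.

Lemma measurable_sqn n : measurable_fun [set: 'rV[R]_n] sqn.
Proof.
apply: (@measurable_sum _ _ _ _ _ _ (fun i (x : 'rV[R]_n) => x ord0 i ^+ 2)) => i.
exact: (measurableT_comp (exprn_measurable 2) (measurable_coord i)).
Qed.

Lemma measurable_shifted_sqn_powR n (tau s : R) :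
  measurable_fun [set: 'rV[R]_n] (fun x => (tau + sqn x) `^ s).
Proof.
apply: (measurableT_comp (measurable_powR s)) => /=.
by apply: measurable_funD => //; exact: measurable_sqn.
Qed.

(** Each factor [tau + x_i^2] is at most [tau + |x|^2]; this reduces integrals
    over R^n to one-dimensional ones. *)
Lemma powR_sqn_le_prod n (tau sg : R) (x : 'rV[R]_n) : 0 < tau -> 0 < sg ->
  (tau + sqn x) `^ (- (n%:R * sg)) <=
  \prod_(i < n) (tau + x ord0 i ^+ 2) `^ (- sg).
Proof.
move=> tau0 sg0.
have P0 : 0 < tau + sqn x by rewrite ltr_wpDr// sqn_ge0.
have pi i : 0 < tau + x ord0 i ^+ 2 by rewrite ltr_wpDr// sqr_ge0.
rewrite (_ : - (n%:R * sg) = - sg * n%:R); last by rewrite mulrC mulNr.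
rewrite powRrM powR_mulrn ?powR_ge0// -[n in _ ^+ n]card_ord -prodr_const.
apply: ler_prod => i _; rewrite powR_ge0/= !powRN lef_pV2 ?posrE ?powR_gt0//.
apply: ge0_ler_powR; rewrite ?nnegrE ?(ltW sg0) ?(ltW (pi i)) ?(ltW P0)// lerD2l.
exact: sqr_le_sqn.
Qed.

(** The exponent of [tau] is the one of the change of variables
    [x = sqrt tau * y], but no change of variables is needed: a product of
    one-dimensional integrals already scales in this way. *)
Lemma Lnorm_decay_le n (p rho : R) : (0 < n)%N -> 0 < p ->
    n%:R < 2 * (rho * p) ->
  exists2 C : R, 0 <= C &
    forall (tau c : R) (f : 'rV[R]_n -> R), 0 < tau -> 0 <= c ->
      measurable_fun setT f ->
      (forall x, `|f x| <= c * (tau + sqn x) `^ (- rho)) ->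
      ('N[lebesgue_rV n]_(p%:E)[EFin \o f] <=
       (C * c * tau `^ (n%:R / (2 * p) - rho))%:E)%E.
Proof.
move=> n0 p0 np.
have n0R : 0 < n%:R :> R by rewrite ltr0n.
pose sg := rho * p / n%:R.
have sg2 : 1 / 2 < sg.
  by rewrite /sg ltr_pdivlMr//; lra.
have sg0 : 0 < sg by lra.
pose C1 : R := 2 * (2 `^ sg / (2 * sg - 1)).
have C10 : 0 <= C1 by rewrite mulr_ge0// divr_ge0 ?powR_ge0//; lra.
exists (C1 `^ (n%:R / p)); first exact: powR_ge0.
move=> tau c f tau0 c0 mf fle.
have i1 := integral_decay_le sg2 tau0.
have mg : measurable_fun setT (fun x : R => (tau + x ^+ 2) `^ (- sg)).
  apply: (measurableT_comp (measurable_powR _)) => /=.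
  exact: measurable_funD.
have I0 : 0 <= C1 * tau `^ (1 / 2 - sg) by rewrite mulr_ge0// powR_ge0.
have i2 := @integral_prod_coord_le R n _ _ mg (fun=> powR_ge0 _ _) I0 i1.
have mprod := @measurable_prod_coord R n _ mg.
have le1 : (\int[lebesgue_rV n]_x `|(EFin \o f) x| `^ p <=
   ((c `^ p) * (C1 * tau `^ (1 / 2 - sg)) ^+ n)%:E)%E.
  rewrite EFinM; apply: le_trans (lee_wpmul2l _ i2); last first.
    by rewrite lee_fin powR_ge0.
  rewrite -ge0_integralZl//; last 3 first.
  - exact/measurable_EFinP.
  - by move=> x _; rewrite lee_fin prodr_ge0// => i _; exact: powR_ge0.
  - by rewrite lee_fin powR_ge0.
  apply: ge0_le_integral => //.
  - by move=> x _; rewrite /= lee_fin powR_ge0.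
  - apply/measurable_EFinP.
    apply: (measurableT_comp (measurable_powR p)) => //=.
    exact: measurableT_comp.
  - by apply: emeasurable_funM => //; exact/measurable_EFinP.
  move=> x _; rewrite /= -EFinM lee_fin.
  apply: (@le_trans _ _ ((c * (tau + sqn x) `^ (- rho)) `^ p)).
    apply: ge0_ler_powR; rewrite ?nnegrE ?(ltW p0)//.
    by rewrite mulr_ge0// powR_ge0.
  rewrite powRM ?powR_ge0// ler_wpM2l ?powR_ge0// -powRrM.
  rewrite (_ : - rho * p = - (n%:R * sg)); first exact: powR_sqn_le_prod.
  by rewrite /sg; field; rewrite gt_eqF.
rewrite unlock.
apply: (@le_trans _ _
   (((c `^ p) * (C1 * tau `^ (1 / 2 - sg)) ^+ n)%:E `^ p^-1)%E).
  apply: gt0_ler_poweR => //.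
  - by rewrite invr_ge0 ltW.
  - by rewrite in_itv/= leey andbT integral_ge0// => x _; exact: poweR_ge0.
  - by rewrite in_itv/= leey andbT lee_fin mulr_ge0 ?powR_ge0// exprn_ge0.
rewrite poweR_EFin lee_fin.
rewrite powRM ?powR_ge0 ?exprn_ge0// -powRrM mulfV ?gt_eqF// powRr1//.
rewrite -powR_mulrn// -powRrM powRM ?powR_ge0// -powRrM.
rewrite mulrCA mulrA le_eqVlt; apply/orP; left; apply/eqP.
by congr (_ * _ `^ _); rewrite /sg; field; rewrite !gt_eqF.
Qed.

(** Lower bound from the cube [0, sqrt tau]^n alone, on which
    [tau + |x|^2 <= (n + 1) tau]. Together with the upper bound it gives the
    exact order of the norm as [tau] tends to 0. *)
Lemma Lnorm_decay_ge n (p rho : R) : 0 < p -> 0 <= rho ->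
  exists2 C : R, 0 < C &
    forall (tau c : R) (f : 'rV[R]_n -> R), 0 < tau -> 0 <= c ->
      measurable_fun setT f ->
      (forall x, c * (tau + sqn x) `^ (- rho) <= `|f x|) ->
      ((C * c * tau `^ (n%:R / (2 * p) - rho))%:E <=
       'N[lebesgue_rV n]_(p%:E)[EFin \o f])%E.
Proof.
move=> p0 rho0.
exists (n.+1%:R `^ (- rho)); first by rewrite powR_gt0.
move=> tau c f tau0 c0 mf fge.
pose rt := Num.sqrt tau.
have rt0 : 0 < rt by rewrite sqrtr_gt0.
have rt2 : rt ^+ 2 = tau by rewrite sqr_sqrtr// ltW.
pose B := [set x : 'rV[R]_n | forall i : 'I_n, (`[0, rt]%classic : set R) (x ord0 i)].
have muB : lebesgue_rV n B = (rt ^+ n)%:E.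
  rewrite (lebesgue_rV_box (A := fun=> `[0, rt]%classic))//.
  under eq_bigr do rewrite lebesgue_measure_itv/= lte_fin rt0 sube0.
  by rewrite prodEFin prodr_const card_ord.
have mB : measurable B.
  rewrite (_ : B = \bigcap_(i in [set: 'I_n])
      ((fun x : 'rV[R]_n => x ord0 i) @^-1` `[0, rt]%classic)).
    apply: fin_bigcap_measurable => // i _; rewrite -[X in measurable X]setTI.
    exact: measurable_coord.
  by apply/seteqP; split=> [x Bx i _|x Bx i]; [exact: Bx|exact: Bx i I].
pose m := c * (n.+1%:R * tau) `^ (- rho).
have m0 : 0 <= m by rewrite mulr_ge0// powR_ge0.
have mfp : measurable_fun setT (fun x => (`|(EFin \o f) x| `^ p)%E).
  apply/measurable_EFinP.
  apply: (measurableT_comp (measurable_powR p)) => //=.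
  exact: measurableT_comp.
have le1 : (((m `^ p) * rt ^+ n)%:E <=
    \int[lebesgue_rV n]_x `|(EFin \o f) x| `^ p)%E.
  rewrite EFinM -muB -integral_cst//.
  apply: (@le_trans _ _ (\int[lebesgue_rV n]_(x in B) `|(EFin \o f) x| `^ p)%E).
    apply: ge0_le_integral => //.
    - by move=> x _; rewrite lee_fin powR_ge0.
    - exact: measurable_funTS.
    move=> x Bx; rewrite /= lee_fin; apply: ge0_ler_powR;
      rewrite ?nnegrE ?(ltW p0)//.
    apply: le_trans (fge x); rewrite ler_wpM2l//.
    have P0 : 0 < tau + sqn x by rewrite ltr_wpDr// sqn_ge0.
    rewrite !powRN lef_pV2 ?posrE ?powR_gt0 ?mulr_gt0//.
    apply: ge0_ler_powR; rewrite ?nnegrE ?(ltW P0)//.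
      by rewrite mulr_ge0// ltW.
    rewrite -natr1 mulrDl mul1r addrC lerD2r.
    rewrite (_ : n%:R * tau = \sum_(i < n) tau); last first.
      by rewrite sumr_const card_ord mulr_natl.
    apply: ler_sum => i _; have := Bx i; rewrite /= in_itv/= => /andP[xi0 xi1].
    by rewrite -rt2 ler_sqr ?nnegrE// ltW.
  by apply: ge0_subset_integral => // x _; rewrite /= lee_fin powR_ge0.
rewrite unlock.
apply: (@le_trans _ _ (((m `^ p) * rt ^+ n)%:E `^ p^-1)%E); last first.
  apply: gt0_ler_poweR => //.
  - by rewrite invr_ge0 ltW.
  - by rewrite in_itv/= leey andbT lee_fin mulr_ge0 ?powR_ge0// exprn_ge0// ltW.
  - by rewrite in_itv/= leey andbT integral_ge0// => x _; exact: poweR_ge0.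
rewrite poweR_EFin lee_fin.
rewrite powRM ?powR_ge0 ?exprn_ge0 ?(ltW rt0)// -powRrM mulfV ?gt_eqF// powRr1//.
rewrite -powR_mulrn ?(ltW rt0)// -powRrM /m /rt -powR12_sqrt ?(ltW tau0)// -powRrM.
rewrite powRM ?(ltW tau0)// le_eqVlt; apply/orP; left; apply/eqP.
rewrite (_ : n%:R / (2 * p) - rho = - rho + 2^-1 * (n%:R / p)); last first.
  by field; rewrite gt_eqF.
rewrite powRD; last by rewrite (gt_eqF tau0) implybT.
ring.
Qed.

End Lnorm_bounds.

(** * Integrals and limits in time *)

Section time_integral.
Context {R : realType}.
Local Notation leb := (@lebesgue_measure R).

(** The integrand is unbounded at 1, so the fundamental theorem of calculus is
    used on [0, 1 - 1/(n+2)] and followed by monotone convergence. *)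
Lemma integral_rsqrt_onem_le :
  (\int[leb]_(t in `]0%R, 1%R[) ((1 - t) `^ (- (1 / 2)))%:E <= 2%:E)%E.
Proof.
pose F (t : R) := - 2 * (1 - t) `^ (1 / 2).
pose A (n : nat) : set R := `[0, 1 - n.+2%:R^-1]%classic.
have an n : (n.+2%:R^-1 : R) < 1 by rewrite invf_lt1// ltr1n.
have an0 n : 0 < (n.+2%:R^-1 : R) by rewrite invr_gt0.
have dpow (s t : R) : t < 1 ->
    is_derive t 1 (fun t : R => (1 - t) `^ s) (- (s * (1 - t) `^ (s - 1))).
  move=> t1; have t10 : 0 < 1 - t by rewrite subr_gt0.
  have dt : is_derive t (1 : R) (cst 1 - id) (- 1 : R).
    by apply: is_derive_eq; rewrite add0r.
  have ds : is_derive ((cst 1 - id) t) (1 : R) (fun y : R => y `^ s) (s * (1 - t) `^ (s - 1)).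
    exact: is_derive1_powR.
  by have := is_derive1_comp ds dt; rewrite mulrN1.
have dF (t : R) : t < 1 -> is_derive t 1 F ((1 - t) `^ (- (1 / 2))).
  move=> t1; apply: is_derive_eq (is_deriveZ (- 2) (dpow (1 / 2) t t1)) _.
  rewrite /GRing.scale /= (_ : 1 / 2 - 1 = - (1 / 2)); last by field.
  by field.
have cpow (s : R) t : t < 1 -> {for t, continuous (fun t : R => (1 - t) `^ s)}.
  move=> t1; apply/differentiable_continuous/derivable1_diffP.
  by have [] := dpow s t t1.
have IA n : (\int[leb]_(t in A n) ((1 - t) `^ (- (1 / 2)))%:E <= 2%:E)%E.
  rewrite /A (@continuous_FTC2 R _ F).
  - rewrite -EFinB lee_fin /F subr0 powR1 mulr1.
    have := @powR_ge0 R (1 - (1 - n.+2%:R^-1)) (1 / 2); lra.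
  - by rewrite subr_gt0.
  - apply: continuous_in_subspaceT => t /[!inE] /= /[!in_itv] /= /andP[_ t1].
    by apply: cpow; apply: le_lt_trans t1 _; rewrite gtrBl.
  - split.
    + move=> t /[!in_itv]/= /andP[_ t1].
      have t1' : t < 1 by apply: lt_trans t1 _; rewrite gtrBl.
      by have [] := dF t t1'.
    + apply: cvg_at_right_filter.
      apply/differentiable_continuous/derivable1_diffP.
      by have [] := dF 0 ltr01.
    + apply: cvg_at_left_filter.
      apply/differentiable_continuous/derivable1_diffP.
      have t1 : 1 - n.+2%:R^-1 < 1 :> R by rewrite gtrBl.
      by have [] := dF _ t1.
  - move=> t /[!in_itv]/= /andP[_ t1]; rewrite derive1E.
    have t1' : t < 1 by apply: lt_trans t1 _; rewrite gtrBl.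
    by have [_ ->] := dF t t1'.
have mp : measurable_fun setT (fun t : R => ((1 - t) `^ (- (1 / 2)))%:E).
  apply/measurable_EFinP; apply: (measurableT_comp (measurable_powR _)) => /=.
  exact: measurable_funB.
have sub : `]0%R, 1%R[%classic `<=` \bigcup_n A n.
  move=> t /=; rewrite in_itv/= => /andP[t0 t1].
  have t10 : 0 < 1 - t by rewrite subr_gt0.
  exists (Num.trunc (1 - t)^-1) => //; rewrite /A /= in_itv/= (ltW t0)/=.
  rewrite lerBrDl -lerBrDr invf_ple ?posrE//.
  have := truncnS_gt (1 - t)^-1.
  move=> /ltW/le_trans; apply; rewrite ler_nat//.
apply: (@le_trans _ _ (\int[leb]_(t in \bigcup_n A n) ((1 - t) `^ (- (1 / 2)))%:E)%E).
  apply: ge0_subset_integral => //.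
  - by apply: bigcup_measurable => n _; exact: measurable_itv.
  - exact: measurable_funTS.
  - by move=> t _; rewrite lee_fin powR_ge0.
have ndA : {homo A : n m / (n <= m)%N >-> (n <= m)%O}.
  move=> n m nm; apply/subsetPset => t; rewrite /A /= !in_itv/=.
  move=> /andP[-> /le_trans]; apply; rewrite lerD2l lerN2.
  by rewrite lef_pV2 ?posrE// ler_nat.
have cv : (\int[leb]_(t in A n) ((1 - t) `^ (- (1 / 2)))%:E)%E @[n --> \oo] -->
    (\int[leb]_(t in \bigcup_n A n) ((1 - t) `^ (- (1 / 2)))%:E)%E.
  apply: ge0_nondecreasing_set_cvg_integral => //.
  - by move=> n; exact: measurable_itv.
  - by move=> n; exact: measurable_funTS.
  - by move=> n t _; rewrite lee_fin powR_ge0.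
rewrite -(cvg_lim _ cv)//; apply: lime_le; last exact: nearW.
by apply/cvg_ex; eexists; exact: cv.
Qed.

End time_integral.

Section mixed_norms.
Context {R : realType} {d : nat}.
Local Notation leb := (@lebesgue_measure R).

(** Measurability in [t] of an integral over [x]: part of Tonelli's theorem. *)
Lemma measurable_Lnorm_section (f : R -> 'rV[R]_d -> R) (p : R) (D : set R) :
  measurable_fun [set: R * 'rV[R]_d] (fun z => f z.1 z.2) ->
  measurable_fun D (fun t => ('N[lebesgue_rV d]_(p%:E)[EFin \o f t])%E).
Proof.
move=> mf; apply: measurable_funTS; rewrite unlock.
apply: (measurableT_comp (measurable_poweR _)).
have := @measurable_fun_fubini_tonelli_F _ _ _ _ R (lebesgue_rV d)
  (fun z : R * 'rV[R]_d => (`|f z.1 z.2| `^ p)%:E).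
apply; last by move=> z; rewrite lee_fin powR_ge0.
apply/measurable_EFinP; apply: (measurableT_comp (measurable_powR p)) => /=.
exact: measurableT_comp.
Qed.

(** Reduces membership in [L^r L^q] to a pointwise-in-time bound [g] of the
    spatial norms and a one-dimensional fact about functions dominated by [g]. *)
Lemma LrLq_of_bound (r : \bar R) (p : R) (f : R -> 'rV[R]_d -> R) (g : R -> R) :
  measurable_fun [set: R * 'rV[R]_d] (fun z => f z.1 z.2) ->
  (forall t, 0 < t < 1 ->
    ('N[lebesgue_rV d]_(p%:E)[EFin \o f t] <= (g t)%:E)%E) ->
  (forall N : R -> \bar R, measurable_fun (`]0%R, 1%R[ : set R) N ->
    (forall t, 0 < t < 1 -> (0 <= N t <= (g t)%:E)%E) ->
    ('N[leb]_r[N \_ `]0%R, 1%R[] < +oo)%E) ->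
  LrLq r p%:E f.
Proof.
move=> mf fg gr; split.
- exact: measurable_funTS.
- exact: measurable_Lnorm_section.
- apply: gr; first exact: measurable_Lnorm_section.
  by move=> t t01; rewrite Lnorm_ge0/= fg.
Qed.

Lemma Lnorm_oo_bounded (c : R) (N : R -> \bar R) :
  (forall t, 0 < t < 1 -> (0 <= N t <= c%:E)%E) ->
  ('N[leb]_+oo[N \_ `]0%R, 1%R[] < +oo)%E.
Proof.
move=> Nc; rewrite unlock; case: ifPn => // _.
apply: (@le_lt_trans _ _ (`|c|%:E)); last exact: ltry.
apply/ess_supP/aeW => t /=; rewrite patchE; case: ifPn => [|_].
  rewrite inE/= in_itv/= => /Nc/andP[N0 Nt]; rewrite gee0_abs//.
  by rewrite (le_trans Nt)// lee_fin ler_norm.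
by rewrite abse0 lee_fin.
Qed.

(** Square integrability in time only needs [2 * (1/4) < 1]. *)
Lemma Lnorm2_rsqrt_onem (c : R) (N : R -> \bar R) : 0 <= c ->
  measurable_fun (`]0%R, 1%R[ : set R) N ->
  (forall t, 0 < t < 1 -> (0 <= N t <= (c * (1 - t) `^ (- (1 / 4)))%:E)%E) ->
  ('N[leb]_(2%:E)[N \_ `]0%R, 1%R[] < +oo)%E.
Proof.
move=> c0 mN Nc; rewrite unlock; apply: poweR_lty.
have -> : (fun t => `|(N \_ `]0%R, 1%R[) t| `^ 2)%E =
    ((fun t => `|N t| `^ 2) \_ `]0%R, 1%R[)%E.
  apply/funext => t; rewrite !patchE; case: ifPn => // _.
  by rewrite abse0 poweR0r// gt_eqF.
rewrite -integral_mkcond.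
have mN2 : measurable_fun (`]0%R, 1%R[ : set R) (fun t => `|N t| `^ 2)%E.
  apply: (measurableT_comp (measurable_poweR _)).
  exact: measurableT_comp.
apply: (@le_lt_trans _ _ (\int[leb]_(t in `]0%R, 1%R[)
    ((c ^+ 2)%:E * ((1 - t) `^ (- (1 / 2)))%:E))%E).
  apply: ge0_le_integral => //.
  - by move=> t _; exact: poweR_ge0.
  - apply: emeasurable_funM => //; apply/measurable_EFinP; apply: measurable_funTS.
    apply: (measurableT_comp (measurable_powR _)) => /=.
    exact: measurable_funB.
  move=> t; rewrite /= in_itv/= => /[dup] t01 /Nc/andP[N0 Nt].
  rewrite gee0_abs//.
  apply: (@le_trans _ _ ((c * (1 - t) `^ (- (1 / 4)))%:E `^ 2)%E).
    apply: gt0_ler_poweR => //; rewrite in_itv/= leey andbT//.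
    by rewrite lee_fin mulr_ge0// powR_ge0.
  rewrite poweR_EFin -EFinM lee_fin powRM// ?powR_ge0// -powRrM.
  rewrite powR_mulrn// le_eqVlt; apply/orP; left; apply/eqP.
  by congr (_ * _ `^ _); field.
rewrite ge0_integralZl//; last 3 first.
- apply/measurable_EFinP; apply: measurable_funTS.
  apply: (measurableT_comp (measurable_powR _)) => /=.
  exact: measurable_funB.
- by move=> t _; rewrite lee_fin powR_ge0.
- by rewrite lee_fin sqr_ge0.
apply: le_lt_trans (lee_wpmul2l _ (@integral_rsqrt_onem_le R)) _.
  by rewrite lee_fin sqr_ge0.
by rewrite -EFinM ltry.
Qed.

Lemma near_onem_powR_ge (C e M : R) : 0 < C -> e < 0 ->
  \forall t \near 1^'-, M <= C * (1 - t) `^ e.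
Proof.
move=> C0 e0.
pose M' := `|M| + 1.
have M'0 : 0 < M' by rewrite ltr_wpDl.
pose r := (M' / C) `^ e^-1.
have MC0 : 0 < M' / C by rewrite divr_gt0.
have r0 : 0 < r by rewrite powR_gt0.
near=> t.
have t1 : t < 1 by near: t; exact: nbhs_left_lt.
have tr : 1 - r < t by near: t; apply: nbhs_left_gt; rewrite gtrBl.
have t10 : 0 < 1 - t by rewrite subr_gt0.
apply: (@le_trans _ _ M'); first by rewrite /M' ler_wpDr// ler_norm.
rewrite -ler_pdivrMl// mulrC.
have -> : M' / C = r `^ e by rewrite /r -powRrM mulVf ?lt_eqF// powRr1// ltW.
rewrite -(opprK e) 2!(powRN _ (- e)) lef_pV2 ?posrE ?powR_gt0//.
apply: ge0_ler_powR; rewrite ?nnegrE ?oppr_ge0 ?(ltW e0) ?(ltW r0) ?(ltW t10)//.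
by move: tr; rewrite ltrBlDr -ltrBlDl => /ltW.
Unshelve. all: by end_near. Qed.

Lemma limf_esup_pinfty (F : set_system R) (f : R -> \bar R) : ProperFilter F ->
  (forall M : R, \forall t \near F, (M%:E <= f t)%E) -> limf_esup f F = +oo%E.
Proof.
move=> FF fM; apply/ereal_inf_pinfty => _ [V FV <-].
(* M is exceeded eventually, in particular at a point of V *)
have {}fM (M : R) : (M%:E <= ereal_sup [set f x | x in V])%E.
  have /filter_ex[t [Vt Mt]] : F (V `&` [set t | (M%:E <= f t)%E]).
    exact: filterI (fM M).
  by apply: le_trans Mt _; apply: ereal_sup_ubound; exists t.
by apply/eqyP => M _; exact: fM.
Qed.

End mixed_norms.

(** * The explicit solution *)

Section solution.
Context {R : realType} {d : nat}.
Local Notation expr := (@expr R d).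

(** The spatial decay exponent of the solution. Any value in the open interval
    from d - 1 to d would do for the norms; for d - 1/2 the velocity
    simplifies. *)
Definition decay : R := d%:R - 1 / 2.
Local Notation a := decay.

(** With [P = tau + |x|^2] and [tau = 1 - t], this is [P^2] times the quadratic
    polynomial in [tau / P] that multiplies [P^(-a/2)] in the solution. *)
Definition weight (tau P : R) : R :=
  P ^+ 2 - a * tau * P + 2 * a * (a + 2) * tau ^+ 2.

Definition drift : R := 2 * a * (a + 2) * (a + 4).

Definition tau_expr : expr := Add (Cst 1) (Mul (Cst (- 1)) (Tm : expr)).

Definition sqn_expr : expr :=
  foldr (fun i e => Add (Mul (Crd i) (Crd i)) e) (Cst 0) (index_enum 'I_d).

Definition P_expr : expr := Add tau_expr sqn_expr.

Definition W_expr : expr :=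
  Add (Mul P_expr P_expr)
    (Add (Mul (Cst (- a)) (Mul tau_expr P_expr))
         (Mul (Cst (2 * a * (a + 2))) (Mul tau_expr tau_expr))).

Definition u_expr : expr := Mul W_expr (Pow P_expr (- (a / 2 + 2))).

Definition b_expr (i : 'I_d) : expr :=
  Mul (Mul (Cst (- drift)) (Mul tau_expr tau_expr))
    (Mul (Mul (Pow P_expr (- 1)) (Pow W_expr (- 1))) (Crd i)).

(** Time derivative of the potential [m = 2 P^(-a/2) + 2 a tau P^(-a/2-1)],
    for which the solution is [div (x m)]. *)
Definition mt_expr : expr :=
  Add (Mul (Cst (- a)) (Pow P_expr (- (a / 2 + 1))))
    (Mul (Cst (a * (a + 2))) (Mul tau_expr (Pow P_expr (- (a / 2 + 2))))).

Definition density (t : R) (x : 'rV[R]_d) : R := eval u_expr t x.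
Definition velocity (t : R) (x : 'rV[R]_d) : 'rV[R]_d := \row_i eval (b_expr i) t x.

Local Notation u := density.
Local Notation b := velocity.

Lemma eval_sqn t x : eval sqn_expr t x = sqn x.
Proof.
rewrite /sqn_expr /sqn; elim: (index_enum _) => [|i s IHs] /=.
  by rewrite big_nil.
by rewrite big_cons IHs expr2.
Qed.

Lemma eval_derivative_sqn o t x : eval (derivative o sqn_expr) t x =
  if o is Some i then 2 * x ord0 i else 0.
Proof.
have -> : eval (derivative o sqn_expr) t x =
    \sum_(j < d) (2 * x ord0 j * (o == Some j)%:R).
  rewrite /sqn_expr; elim: (index_enum _) => [|j s IHs] /=.
    by rewrite big_nil.
  by rewrite big_cons IHs; congr (_ + _); ring.
case: o => [i|]; last by rewrite big1// => j _; rewrite mulr0.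
rewrite (bigD1 i)//= eqxx mulr1 big1 ?addr0// => j ji.
by rewrite (inj_eq Some_inj) eq_sym (negbTE ji) mulr0.
Qed.

Lemma eval_tau t x : eval tau_expr t x = 1 - t.
Proof. by rewrite /=; ring. Qed.

Lemma eval_P t x : eval P_expr t x = 1 - t + sqn x.
Proof. by rewrite /= eval_sqn; ring. Qed.

Lemma eval_W t x : eval W_expr t x = weight (1 - t) (1 - t + sqn x).
Proof. by rewrite /= eval_sqn /weight; ring. Qed.

Lemma uE t x : u t x =
  weight (1 - t) (1 - t + sqn x) * (1 - t + sqn x) `^ (- (a / 2 + 2)).
Proof. by rewrite -eval_W -eval_P. Qed.

Context (d_gt0 : (0 < d)%N).

Lemma decay_gt0 : 0 < a.
Proof.
have d1 : (1 : R) <= d%:R by rewrite ler1n.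
by rewrite /decay; lra.
Qed.

Lemma drift_ge0 : 0 <= drift.
Proof. by have a0 := ltW decay_gt0; rewrite /drift !mulr_ge0// addr_ge0. Qed.

(** The discriminant of [1 - a theta + 2 a (a + 2) theta^2] is negative; the
    square is completed so as to leave a definite multiple of [P^2]. *)
Lemma weight_ge tau P : P ^+ 2 / 2 <= weight tau P.
Proof.
have a0 := decay_gt0; rewrite -subr_ge0.
rewrite (_ : _ - _ = (P - a * tau) ^+ 2 / 2 +
    (3 / 2 * a ^+ 2 + 4 * a) * tau ^+ 2); last by rewrite /weight; field.
rewrite addr_ge0 ?divr_ge0 ?sqr_ge0// mulr_ge0 ?sqr_ge0//.
by rewrite addr_ge0 ?mulr_ge0 ?sqr_ge0 ?divr_ge0// ltW.
Qed.

Lemma weight_le tau P : 0 <= tau <= P ->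
  weight tau P <= (1 + 2 * a * (a + 2)) * P ^+ 2.
Proof.
have a0 := decay_gt0; move=> /andP[tau0 tauP]; rewrite -subr_ge0.
rewrite (_ : _ - _ = a * (tau * P) + 2 * a * (a + 2) * ((P - tau) * (P + tau))).
  have P0 := le_trans tau0 tauP.
  have a0' := ltW a0.
  rewrite addr_ge0//; first by rewrite !mulr_ge0.
  apply: mulr_ge0; first by rewrite !mulr_ge0// addr_ge0.
  by apply: mulr_ge0; [rewrite subr_ge0|exact: addr_ge0].
by rewrite /weight; ring.
Qed.

Lemma shifted_sqn_gt0 t (x : 'rV[R]_d) : t < 1 -> 0 < 1 - t + sqn x.
Proof. by move=> t1; rewrite ltr_wpDr ?sqn_ge0// subr_gt0. Qed.

Lemma weight_gt0 tau P : 0 < P -> 0 < weight tau P.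
Proof. by move=> P0; apply: lt_le_trans (weight_ge _ _); rewrite divr_gt0// exprn_gt0. Qed.

Lemma admissible_P : admissible P_expr.
Proof.
split=> //=; rewrite /sqn_expr.
by elim: (index_enum _) => [|i s IHs] /=.
Qed.

Lemma admissible_W : admissible W_expr.
Proof. by have := admissible_P; rewrite /W_expr /=; tauto. Qed.

Lemma admissible_PowP r : admissible (Pow P_expr r).
Proof.
by split=> [|t x t1]; [exact: admissible_P|rewrite eval_P shifted_sqn_gt0].
Qed.

Lemma admissible_u : admissible u_expr.
Proof. by split; [exact: admissible_W|exact: admissible_PowP]. Qed.

Lemma admissible_b i : admissible (b_expr i).
Proof.
split=> //; split=> //; split; first exact: admissible_PowP.
split=> [|t x t1]; first exact: admissible_W.
by rewrite eval_W weight_gt0 ?shifted_sqn_gt0.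
Qed.

Lemma admissible_mt : admissible mt_expr.
Proof. by split; split=> //; [exact: admissible_PowP|split=> //; exact: admissible_PowP]. Qed.

Lemma powR_oppSr (P s : R) : 0 < P -> P `^ (- s) = P `^ (- (s + 1)) * P.
Proof.
move=> P0; rewrite -{3}(powRr1 (ltW P0)) -powRD.
  by congr (_ `^ _); ring.
by rewrite (gt_eqF P0) implybT.
Qed.

(** The choice of [m] makes the terms of order [tau^0] and [tau^1] of
    [2 d_s u - d_t m] vanish at fixed [P], where [s = |x|^2]: only
    [tau^2 P^(-a/2-3)] is left, and dividing by [u] gives a velocity that is a rational function. *)
Lemma flux_identity i t x : t < 1 ->
  eval (Mul u_expr (b_expr i)) t x =
  eval (Add (derivative (Some i) u_expr)
            (Mul (Cst (- 1)) (Mul (Crd i) mt_expr))) t x.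
Proof.
move=> t1; have P0 := shifted_sqn_gt0 x t1; have W0 := weight_gt0 (1 - t) P0.
rewrite [LHS]/= [RHS]/= !eval_sqn !eval_derivative_sqn.
rewrite (_ : 1 + - 1 * t = 1 - t); last by ring.
rewrite (_ : _ + (- a * _ + _) = weight (1 - t) (1 - t + sqn x)); last first.
  by rewrite /weight; ring.
rewrite !powR_inv1 ?(ltW P0) ?(ltW W0)//.
set P := 1 - t + sqn x in P0 W0 *; set tau := 1 - t in W0 *.
set W := weight tau P in W0 *.
rewrite (_ : - (a / 2 + 2) - 1 = - (a / 2 + 3)); last by ring.
rewrite (powR_oppSr (a / 2 + 1) P0) (_ : a / 2 + 1 + 1 = a / 2 + 2); last by ring.
rewrite (powR_oppSr (a / 2 + 2) P0) (_ : a / 2 + 2 + 1 = a / 2 + 3); last by ring.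
(* every power of P is now p times a polynomial in P *)
set p := _ `^ _.
transitivity (- drift * tau ^+ 2 * x ord0 i * p).
  by field; rewrite !gt_eqF.
by rewrite /drift /W /weight; field.
Qed.

Lemma partial_x_eval i (e : expr) t : admissible e -> t < 1 ->
  partial_x i (eval e t) = eval (derivative (Some i) e) t.
Proof.
move=> ae t1; apply/funext => x; rewrite /partial_x.
by have [_ ->] := is_derive_eval_x i x ae t1.
Qed.

(** [d_t u = d_t div (x m) = div (x d_t m)], checked on the explicit formulas. *)
Lemma continuity_identity t x : t < 1 ->
  eval (derivative None u_expr) t x =
  \sum_(i < d) eval (derivative (Some i) (Mul (Crd i) mt_expr)) t x.
Proof.
move=> t1; have P0 := shifted_sqn_gt0 x t1.
have dR : d%:R = a + 1 / 2 :> R by rewrite /decay subrK.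
under eq_bigr => i _ do rewrite /= eqxx mulr1 !eval_sqn !eval_derivative_sqn.
rewrite [LHS]/= !eval_sqn !eval_derivative_sqn /=.
rewrite (_ : 1 + - 1 * t = 1 - t); last by ring.
set P := 1 - t + sqn x in P0 *; set tau := 1 - t.
rewrite (_ : - (a / 2 + 2) - 1 = - (a / 2 + 3)); last by ring.
rewrite (_ : - (a / 2 + 1) - 1 = - (a / 2 + 2)); last by ring.
rewrite (powR_oppSr (a / 2 + 1) P0) (_ : a / 2 + 1 + 1 = a / 2 + 2); last by ring.
rewrite (powR_oppSr (a / 2 + 2) P0) (_ : a / 2 + 2 + 1 = a / 2 + 3); last by ring.
set p := _ `^ _.
(* G is d_t m and H is twice its derivative in |x|^2 *)
pose G := - a * p * P ^+ 2 + a * (a + 2) * tau * p * P.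
pose H := 2 * a * (a / 2 + 1) * p * P - 2 * a * (a + 2) * (a / 2 + 2) * tau * p.
transitivity (\sum_(i < d) (G + H * x ord0 i ^+ 2)); last first.
  by apply: eq_bigr => i _; rewrite /G /H; ring.
rewrite big_split/= sumr_const card_ord -mulr_sumr -/(sqn x) -(mulr_natl G) dR.
rewrite (_ : sqn x = P - tau); last by rewrite /P addrC addKr.
by rewrite /G /H; field.
Qed.

(** Since [u b = grad u - x d_t m], the divergence of the flux is
    [laplacian u - div (x d_t m)], and the last term is [d_t u]. *)
Lemma advection_diffusion t x : 0 <= t < 1 ->
  partial_t u t x + divergence (fun y => u t y *: b t y) x = laplacian (u t) x.
Proof.
move=> t01; have /andP[_ t1] := t01.
have au := admissible_u; have am := admissible_mt.
have -> : partial_t u t x = eval (derivative None u_expr) t x.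
  by have /(_ t t01) := @agree_partial_tx R d None u u_expr au (fun=> fun=> erefl);
    move=> /(congr1 (@^~ x)).
rewrite continuity_identity// /divergence /laplacian -big_split/=.
apply: eq_bigr => i _.
have -> : (fun y => (u t y *: b t y) ord0 i) =
    eval (Add (derivative (Some i) u_expr)
            (Mul (Cst (- 1)) (Mul (Crd i) mt_expr))) t.
  by apply/funext => y; rewrite -flux_identity// !mxE.
have adu := admissible_derivative (Some i) au.
rewrite [u t](_ : _ = eval u_expr t)// !partial_x_eval//.
by rewrite /=; ring.
Qed.

End solution.

Section pointwise_bounds.
Context {R : realType} {d : nat}.
Context (d_gt0 : (0 < d)%N).
Local Notation a := (@decay R d).
Local Notation u := (@density R d).
Local Notation b := (@velocity R d).
Local Notation drift := (@drift R d).

Lemma sqr_mul_powR (P s : R) : 0 < P -> P ^+ 2 * P `^ (- (s + 2)) = P `^ (- s).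
Proof.
move=> P0; rewrite -powR_mulrn ?(ltW P0)// -powRD; last by rewrite (gt_eqF P0) implybT.
by congr (_ `^ _); ring.
Qed.

Lemma u_ge t x : t < 1 -> 1 / 2 * (1 - t + sqn x) `^ (- (a / 2)) <= u t x.
Proof.
move=> t1; have P0 := shifted_sqn_gt0 x t1.
rewrite uE -(sqr_mul_powR _ P0) mulrA ler_wpM2r ?powR_ge0//.
by have := weight_ge d_gt0 (1 - t) (1 - t + sqn x); rewrite mulrC mul1r.
Qed.

Lemma u_le t x : t < 1 ->
  u t x <= (1 + 2 * a * (a + 2)) * (1 - t + sqn x) `^ (- (a / 2)).
Proof.
move=> t1; have P0 := shifted_sqn_gt0 x t1.
rewrite uE -(sqr_mul_powR _ P0) mulrA ler_wpM2r ?powR_ge0//.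
apply: weight_le => //; rewrite subr_ge0 (ltW t1)/= lerDl.
exact: sqn_ge0.
Qed.

Lemma normr_u t x : t < 1 -> `|u t x| = u t x.
Proof.
move=> t1; apply: ger0_norm; apply: le_trans (u_ge x t1).
by rewrite mulr_ge0 ?powR_ge0// divr_ge0.
Qed.

Lemma eucl_norm_b t x : t < 1 -> eucl_norm (b t x) =
  drift * (1 - t) ^+ 2 / ((1 - t + sqn x) * @weight R d (1 - t) (1 - t + sqn x)) *
  Num.sqrt (sqn x).
Proof.
move=> t1; have P0 := shifted_sqn_gt0 x t1; have W0 := weight_gt0 d_gt0 (1 - t) P0.
have a0 := decay_gt0 (R := R) d_gt0.
have k0 : 0 <= drift by exact: drift_ge0.
set k := drift * _ / _.
have kge0 : 0 <= k.
  apply: divr_ge0; last by apply: mulr_ge0; exact: ltW.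
  by apply: mulr_ge0 => //; exact: sqr_ge0.
rewrite /eucl_norm (_ : \sum_(i < d) _ = k ^+ 2 * sqn x).
  by rewrite sqrtrM ?sqr_ge0// sqrtr_sqr ger0_norm.
rewrite /sqn mulr_sumr; apply: eq_bigr => i _; rewrite mxE -exprMn.
have -> : eval (b_expr i) t x = - (k * x ord0 i).
  rewrite /b_expr.
  rewrite [LHS](_ : _ = - drift * (eval (@tau_expr R d) t x * eval (@tau_expr R d) t x) *
    (eval (@P_expr R d) t x `^ (- 1) * eval (@W_expr R d) t x `^ (- 1) * x ord0 i))//.
  rewrite eval_tau eval_P eval_W !powR_inv1 ?(ltW P0) ?(ltW W0)// /k.
  by field; rewrite !gt_eqF.
by rewrite sqrrN.
Qed.

(** With [r = |x|] this is [tau^2 r / P^3 <= sqrt tau / P]: the factor [sqrt tau]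
    is what makes the L^d norm independent of [tau]. *)
Lemma eucl_norm_b_le t x : t < 1 ->
  eucl_norm (b t x) <= 2 * drift * Num.sqrt (1 - t) * (1 - t + sqn x) `^ (- 1).
Proof.
move=> t1; have P0 := shifted_sqn_gt0 x t1; have W0 := weight_gt0 d_gt0 (1 - t) P0.
have a0 := decay_gt0 (R := R) d_gt0.
have k0 : 0 <= drift by exact: drift_ge0.
rewrite eucl_norm_b// powR_inv1 ?(ltW P0)//.
have t10 : 0 < 1 - t by rewrite subr_gt0.
set rt := Num.sqrt (1 - t); set r := Num.sqrt (sqn x).
have rt0 : 0 <= rt by exact: sqrtr_ge0.
have r0 : 0 <= r by exact: sqrtr_ge0.
have Wge := weight_ge d_gt0 (1 - t) (1 - t + sqn x).
set W := weight _ _ in W0 Wge *.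
have key : rt ^+ 4 * r <= rt * (1 - t + sqn x) ^+ 2.
  rewrite -(sqr_sqrtr (ltW t10)) -(sqr_sqrtr (sqn_ge0 x)) -/rt -/r.
  rewrite exprS -mulrA ler_wpM2l//.
  have h1 : rt ^+ 3 * r <= rt ^+ 2 * (rt ^+ 2 + r ^+ 2).
    rewrite exprSr -mulrA ler_wpM2l ?sqr_ge0//.
    by have := sqr_ge0 (rt - r); nra.
  apply: le_trans h1 _; rewrite [leRHS]expr2 ler_wpM2r ?addr_ge0 ?sqr_ge0//.
  by rewrite lerDl sqr_ge0.
rewrite -[in (1 - t) ^+ 2](sqr_sqrtr (ltW t10)) -/rt -exprM.
set P := 1 - t + sqn x in P0 W0 Wge key *.
rewrite (_ : drift * rt ^+ (2 * 2) / (P * W) * r =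
    drift * (rt ^+ 4 * r) / (P * W)); last by field; rewrite !gt_eqF.
rewrite ler_pdivrMr ?mulr_gt0//.
rewrite (_ : 2 * drift * rt / P * (P * W) = drift * (rt * (2 * W))); last first.
  by field; rewrite gt_eqF.
rewrite ler_wpM2l//; apply: le_trans key _; rewrite ler_wpM2l//.
by move: Wge; rewrite ler_pdivrMr// mulrC.
Qed.

End pointwise_bounds.

(** * Integrability and blow-up *)

Theorem theorem5p3 (R : realType) (d : nat) (hd : (1 < d)%N) :
  let q : \bar R := (d%:R / (d%:R - 1))%:E in
  exists (b : R -> 'rV[R]_d -> 'rV[R]_d) (u : R -> 'rV[R]_d -> R),
    [/\ LrLq_rV +oo%E (d%:R)%:E b,
        smooth_tx_rV b,
        smooth_tx u &
        LrLq 2%:E q u] /\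
    (forall t x, 0 <= t < 1 ->
      partial_t u t x + divergence (fun y => u t y *: b t y) x =
      laplacian (u t) x) /\
    [/\ u 0 \in Lfun (lebesgue_rV d) 2%:E,
        u 0 \in Lfun (lebesgue_rV d) q,
        u 0 \in Lfun (lebesgue_rV d) +oo%E &
        smooth_x (u 0)] /\
    [/\ limf_esup (fun t => (u t 0)%:E) 1^'- = +oo%E,
        ('N[lebesgue_rV d]_q[EFin \o u t])%E @[t --> 1^'-] --> +oo%E &
        ('N[lebesgue_rV d]_(2%:E)[EFin \o u t])%E @[t --> 1^'-] --> +oo%E].
Proof.
have d_gt0 : (0 < d)%N by exact: ltnW.
have dR : 1 < d%:R :> R by rewrite ltr1n.
have d2 : 2 <= d%:R :> R by rewrite ler_nat.
have a0 := decay_gt0 (R := R) d_gt0.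
have aE : @decay R d = d%:R - 1 / 2 by [].
set q : R := d%:R / (d%:R - 1).
have q0 : 0 < q by rewrite divr_gt0//; lra.
set K : R := 1 + 2 * @decay R d * (@decay R d + 2).
have K0 : 0 <= K.
  by have a0' := ltW a0; rewrite addr_ge0// !mulr_ge0// addr_ge0.
have k0 : 0 <= @drift R d by exact: drift_ge0.
have mu : measurable_fun [set: R * 'rV[R]_d] (fun z => density z.1 z.2).
  exact: measurable_eval.
have mut t : measurable_fun [set: 'rV[R]_d] (density t).
  exact: (measurableT_comp mu (measurable_pair1 t)).
have mb : measurable_fun [set: R * 'rV[R]_d] (fun z => velocity z.1 z.2).
  apply/measurable_fun_coordP => i.
  rewrite (_ : (fun _ => _) = fun z => eval (b_expr i) z.1 z.2).
    exact: measurable_eval.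
  by apply/funext => z; rewrite mxE.
have mnb : measurable_fun [set: R * 'rV[R]_d] (fun z => eucl_norm (velocity z.1 z.2)).
  rewrite (_ : (fun _ => _) = fun z => (0 + sqn (velocity z.1 z.2)) `^ 2^-1).
    exact: (measurableT_comp (measurable_shifted_sqn_powR _ _) mb).
  by apply/funext => z; rewrite add0r powR12_sqrt// sqn_ge0.
have mnbt t : measurable_fun [set: 'rV[R]_d] (fun x => eucl_norm (velocity t x)).
  exact: (measurableT_comp mnb (measurable_pair1 t)).
have uNle t : t < 1 -> forall x : 'rV[R]_d,
    `|density t x| <= K * (1 - t + sqn x) `^ (- (@decay R d / 2)).
  by move=> t1 x; rewrite normr_u//; exact: u_le.
have uNge t : t < 1 -> forall x : 'rV[R]_d,
    1 / 2 * (1 - t + sqn x) `^ (- (@decay R d / 2)) <= `|density t x|.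
  by move=> t1 x; rewrite normr_u//; exact: u_ge.
have half0 : 0 <= 1 / 2 :> R by rewrite divr_ge0.
have ha0 : 0 <= @decay R d / 2 by rewrite divr_ge0// ltW.
(* d < a q: the solution is in L^q, with a norm of order (1 - t)^(-1/4) *)
have qd : d%:R < 2 * (@decay R d / 2 * q).
  rewrite (_ : 2 * (@decay R d / 2 * q) = d%:R * (@decay R d / (d%:R - 1))); last first.
    by rewrite /q; field; rewrite gt_eqF// subr_gt0.
  by rewrite ltr_pMr ?ltr_pdivlMr; lra.
have d4 : d%:R < 2 * (@decay R d / 2 * 2) by rewrite aE; lra.
have eq_q : d%:R / (2 * q) - @decay R d / 2 = - (1 / 4).
  rewrite aE /q; field; apply/andP; split; rewrite gt_eqF//; lra.
have e2 : d%:R / (2 * 2) - @decay R d / 2 < 0 by rewrite aE; lra.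
have [Cq Cq0 Cqle] := Lnorm_decay_le d_gt0 q0 qd.
have [C2 C20 C2le] := Lnorm_decay_le d_gt0 (ltr0n R 2) d4.
(* the lower bound applies to both exponents q and 2 *)
have blow (p : R) : 0 < p -> d%:R / (2 * p) - @decay R d / 2 < 0 ->
    (('N[lebesgue_rV d]_(p%:E)[EFin \o density t])%E @[t --> 1^'-] --> +oo%E).
  move=> p0 ep; have [C C0 Cge] := Lnorm_decay_ge d p0 ha0.
  apply/cvgeyPge => M.
  have C20' : 0 < C * (1 / 2) by rewrite mulr_gt0// divr_gt0.
  near=> t.
  have t1 : t < 1 by near: t; exact: nbhs_left_lt.
  apply: le_trans (Cge (1 - t) _ _ _ half0 (mut t) (uNge t t1)).
    by rewrite lee_fin; near: t; exact: near_onem_powR_ge.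
  by rewrite subr_gt0.
have u0fin (p : \bar R) : ('N[lebesgue_rV d]_p[EFin \o density 0%R] < +oo)%E ->
    density 0 \in Lfun (lebesgue_rV d) p.
  by move=> h; rewrite inE; apply/andP; split; rewrite inE//=; exact: mut.
exists velocity, density; split; [split|split; [|split; split]].
- split; first exact: measurable_funTS.
  have [Cb Cb0 Cble] := @Lnorm_decay_le R d d%:R 1 d_gt0 (lt_trans ltr01 dR) ltac:(lra).
  apply: (@LrLq_of_bound _ _ _ _ _ (fun=> Cb * (2 * @drift R d))) => //.
    move=> t /andP[_ t1]; have t10 : 0 < 1 - t by rewrite subr_gt0.
    apply: le_trans (Cble (1 - t) (2 * @drift R d * Num.sqrt (1 - t)) _ t10 _ (mnbt t) _) _.
    + by apply: mulr_ge0; [exact: mulr_ge0|exact: sqrtr_ge0].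
    + move=> x; rewrite ger0_norm ?sqrtr_ge0//; exact: eucl_norm_b_le.
    (* the powers 1/2 of the factor sqrt tau and d/(2d) - 1 cancel *)
    rewrite lee_fin -powR12_sqrt ?(ltW t10)// !mulrA -[leLHS]mulrA -powRD; last first.
      by rewrite (gt_eqF t10) implybT.
    rewrite (_ : 2^-1 + _ = 0) ?powRr0 ?mulr1//.
    by field; rewrite gt_eqF// (lt_trans ltr01 dR).
  by move=> N _; exact: Lnorm_oo_bounded.
- move=> i; apply: (@agree_smooth_tx _ _ _ (b_expr i)); first exact: admissible_b.
  by move=> t _; apply/funext => x; rewrite mxE.
- by apply: (agree_smooth_tx admissible_u).
- apply: (@LrLq_of_bound _ _ _ _ _ (fun t => Cq * K * (1 - t) `^ (- (1 / 4)))) => //.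
    move=> t /andP[_ t1]; rewrite -eq_q.
    by apply: Cqle (uNle t t1) => //; rewrite subr_gt0.
  by move=> N mN; apply: Lnorm2_rsqrt_onem => //; exact: mulr_ge0.
- exact: advection_diffusion.
- apply: u0fin; apply: le_lt_trans (C2le (1 - 0) K _ _ K0 (mut 0) (uNle 0 ltr01)) (ltry _).
  by rewrite subr0.
- apply: u0fin; apply: le_lt_trans (Cqle (1 - 0) K _ _ K0 (mut 0) (uNle 0 ltr01)) (ltry _).
  by rewrite subr0.
- apply: u0fin; rewrite unlock; case: ifPn => // _.
  apply: (@le_lt_trans _ _ K%:E); last exact: ltry.
  apply/ess_supP/aeW => x /=; rewrite lee_fin.
  apply: le_trans (uNle 0 ltr01 x) _; rewrite ler_piMr// subr0.
  have P1 : 1 <= 1 + sqn x :> R by rewrite lerDl sqn_ge0.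
  have na0 : - (@decay R d / 2) <= 0 by rewrite oppr_le0.
  by have := ler_powR P1 na0; rewrite powRr0.
- exact: (smooth_x_eval admissible_u ltr01).
- apply: limf_esup_pinfty => M; near=> t.
  have t1 : t < 1 by near: t; exact: nbhs_left_lt.
  rewrite lee_fin; apply: le_trans (u_ge d_gt0 0 t1).
  rewrite (_ : sqn 0 = 0) ?addr0; last first.
    by rewrite /sqn big1// => i _; rewrite mxE expr0n.
  near: t; apply: near_onem_powR_ge; first by rewrite divr_gt0.
  by rewrite oppr_lt0 divr_gt0.
- by apply: blow => //; rewrite eq_q oppr_lt0 divr_gt0.
- exact: blow.
Unshelve. all: by end_near. Qed.
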